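(* Let $r,s,t,u\in\mathbb{R}\setminus\{0\}$ and $\vartheta\in\{p,bp,r\}$. Then the $\gamma$-dual of $B[\mathcal{C}_f]$ is $\{B[\mathcal{C}_f]\}^{\gamma}=d_1\cap\mathcal{CS}_{\vartheta}$, where $$d_1=\left\{a=(a_{kl})\in\Omega:\ \sup_{m,n\in\mathbb{N}}\sum_{k=0}^{m}\sum_{l=0}^{n}\left|\sum_{j=k}^{m}\sum_{i=l}^{n}\left(\frac{-s}{r}\right)^{j-k}\left(\frac{-u}{t}\right)^{i-l}\frac{a_{ji}}{rt}\right|<\infty\right\}.$$
   Context: $\mathbb{N}=\{0,1,2,\dots\}$; $\Omega$ is the vector space of all complex double sequences $x=(x_{kl})_{k,l\in\mathbb{N}}$. $\mathcal{C}_p$ is the set of double sequences convergent in Pringsheim's sense (both indices tend to infinity independently; limit $p$-$\lim$); $\mathcal{C}_{bp}$ is the set of bounded members of $\mathcal{C}_p$; $\mathcal{C}_r$ is the set of members of $\mathcal{C}_p$ all of whose rows and columns are convergent single sequences. $\mathcal{CS}_\vartheta$ is the set of $x\in\Omega$ whose sequence of rectangular partial sums $\sum_{k=0}^m\sum_{l=0}^n x_{kl}$ lies in $\mathcal{C}_\vartheta$; $\mathcal{BS}$ is the set of $x\in\Omega$ whose sequence of rectangular partial sums is bounded. The $\gamma$-dual of $\lambda\subset\Omega$ is $\lambda^{\gamma}=\{a\in\Omega:(a_{kl}x_{kl})\in\mathcal{BS}\text{ for all }x\in\lambda\}$. $[\mathcal{C}_f]$ (strongly almost convergent double sequences) is the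 set of $x\in\Omega$ for which there is $L\in\mathbb{C}$ with $$p\text{-}\lim_{q,q'\to\infty}\ \sup_{m,n\in\mathbb{N}}\frac{1}{(q+1)(q'+1)}\sum_{k=m}^{m+q}\sum_{l=n}^{n+q'}|x_{kl}-L|=0.$$ The matrix $B=B(r,s,t,u)$ acts by $(Bx)_{mn}=su\,x_{m-1,n-1}+st\,x_{m-1,n}+ru\,x_{m,n-1}+rt\,x_{mn}$, where terms with a negative index are $0$. $B[\mathcal{C}_f]=\{x\in\Omega: Bx\in[\mathcal{C}_f]\}$. *)

(* Defs.v *)
From HB Require Import structures.
From mathcomp Require Import all_boot all_order all_algebra.
From mathcomp Require Import all_classical all_reals all_analysis.
From mathcomp Require Export complex.

Set Implicit Arguments.
Unset Strict Implicit.
Unset Printing Implicit Defensive.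

Import Order.TTheory GRing.Theory Num.Theory.
Import numFieldNormedType.Exports.
Local Open Scope classical_set_scope.
Local Open Scope ring_scope.
Local Open Scope complex_scope.

Definition dseq (R : realType) : Type := nat -> nat -> R[i].

(* The library norm `|z| of a complex number is again an element of R[i]; this
   is the modulus as an element of R. *)
Definition modulus (R : realType) (z : R[i]) : R := ComplexField.Normc.normc z.

(* R[i]^o (the field as a module over itself) carries the usual topology of the
   complex plane, whereas R[i] alone has no declared topology. *)
Definition p_lim (R : realType) (x : dseq R) (L : R[i]) : Prop :=
  (fun mn : nat * nat => x mn.1 mn.2 : R[i]^o) @ filter_prod \oo \oo
    --> (L : R[i]^o).

Definition seq_cvg (R : realType) (z : nat -> R[i]) : Prop :=
  exists L : R[i], (fun n => z n : R[i]^o) @ \oo --> (L : R[i]^o).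

Definition dseq_bounded (R : realType) (x : dseq R) : Prop :=
  exists M : R, forall m n, modulus (x m n) <= M.

Definition C_p (R : realType) : set (dseq R) :=
  [set x | exists L : R[i], p_lim x L].

Definition C_bp (R : realType) : set (dseq R) :=
  [set x | C_p x /\ dseq_bounded x].

Definition C_r (R : realType) : set (dseq R) :=
  [set x | [/\ C_p x,
               forall m, seq_cvg (fun n => x m n) &
               forall n, seq_cvg (fun m => x m n)]].

Inductive cvg_mode : Set := mode_p | mode_bp | mode_r.

Definition C_mode (R : realType) (theta : cvg_mode) : set (dseq R) :=
  match theta with
  | mode_p => @C_p R
  | mode_bp => @C_bp R
  | mode_r => @C_r R
  end.

Definition partial_sum (R : realType) (x : dseq R) : dseq R :=
  fun m n => \sum_(0 <= k < m.+1) \sum_(0 <= l < n.+1) x k l.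

Definition CS (R : realType) (theta : cvg_mode) : set (dseq R) :=
  [set x | C_mode theta (partial_sum x)].

Definition BS (R : realType) : set (dseq R) :=
  [set x | dseq_bounded (partial_sum x)].

Definition gamma_dual (R : realType) (lambda : set (dseq R)) : set (dseq R) :=
  [set a | forall x, lambda x -> BS (fun k l => a k l * x k l)].

Definition window_mean (R : realType) (x : dseq R) (L : R[i])
    (q q' m n : nat) : R :=
  (q.+1%:R * q'.+1%:R)^-1 *
    \sum_(m <= k < (m + q).+1) \sum_(n <= l < (n + q').+1) modulus (x k l - L).

(* The supremum is taken in \bar R since x is not assumed to be bounded. *)
Definition strongly_almost_cvg (R : realType) : set (dseq R) :=
  [set x | exists L : R[i],
    (fun q : nat * nat => ereal_sup
       (range (fun m : nat * nat =>
          (window_mean x L q.1 q.2 m.1 m.2)%:E)))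
      @ filter_prod \oo \oo --> (0 : \bar R)%E].

(* x_{m-1,n} and x_{m,n-1}, with value 0 at a negative index. *)
Definition shift1 (R : realType) (x : dseq R) : dseq R :=
  fun m n => if m is m'.+1 then x m' n else 0.

Definition shift2 (R : realType) (x : dseq R) : dseq R :=
  fun m n => if n is n'.+1 then x m n' else 0.

Definition B_transform (R : realType) (r s t u : R) (x : dseq R) : dseq R :=
  fun m n =>
    (s * u)%:C * shift1 (shift2 x) m n + (s * t)%:C * shift1 x m n
    + (r * u)%:C * shift2 x m n + (r * t)%:C * x m n.

Definition B_domain (R : realType) (r s t u : R) (lambda : set (dseq R)) :
    set (dseq R) :=
  [set x | lambda (B_transform r s t u x)].

Definition d1 (R : realType) (r s t u : R) : set (dseq R) :=
  [set a : dseq R |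
    (ereal_sup (range (fun mn : nat * nat =>
      (\sum_(0 <= k < mn.1.+1) \sum_(0 <= l < mn.2.+1)
        modulus (\sum_(k <= j < mn.1.+1) \sum_(l <= i < mn.2.+1)
          ((- s / r) ^+ (j - k) * (- u / t) ^+ (i - l))%:C
            * (a j i / (r * t)%:C)))%:E)) < +oo)%E].

(* Main.v *)
Require Import Defs.
From mathcomp Require Import all_boot all_order all_algebra.
From mathcomp Require Import all_classical all_reals all_analysis.
From mathcomp Require Import ring lra zify.
Import Order.TTheory GRing.Theory Num.Theory.
Import numFieldNormedType.Exports.
Local Open Scope classical_set_scope.
Local Open Scope ring_scope.

Set Implicit Arguments.
Unset Strict Implicit.
Unset Printing Implicit Defensive.

(** The operator B is the composition of a two-term operator in each index.
    Summing by parts, the rectangular sums of [a x] are the pairings of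
    [y = B x] with the kernels D^{mn} whose absolute sums are bounded in d_1.
    Every [y] in [C_f] is bounded, so d_1 lies in the gamma-dual; conversely
    [C_f] contains all sequences vanishing at infinity, B is onto, and a gliding
    hump shows that the kernels pair boundedly with all of these only if their
    absolute sums are bounded.  The CS-condition is automatic: applying
    the transpose of B to D^{mn} gives back [a] on the rectangle, so
    membership in d_1 forces [a] to be absolutely summable. *)

(** * Two-term operators in one and two indices, their transposes and inverses *)

Section TwoTermOperator.
Variable F : fieldType.
Implicit Types (f x y : nat -> F) (g z : nat -> nat -> F).

Definition delay x k := if k is k'.+1 then x k' else 0.

(** Reindexing moves the shift from [f] to [x]. No boundary term survives, because [f N = 0] at one
    end and [delay x 0 = 0] at the other. *)
Lemma sum_by_parts (r s : F) f x N : f N = 0 ->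
  \sum_(0 <= k < N) (r * f k + s * f k.+1) * x k =
  \sum_(0 <= k < N) f k * (r * x k + s * delay x k).
Proof.
move=> fN.
have shift : \sum_(0 <= k < N) f k.+1 * x k = \sum_(0 <= k < N) f k * delay x k.
  transitivity (\sum_(0 <= k < N.+1) f k * delay x k).
    by rewrite big_nat_recl//= mulr0 add0r.
  by rewrite big_nat_recr//= fN mul0r addr0.
under eq_bigr do rewrite mulrDl -!mulrA.
under [RHS]eq_bigr do rewrite mulrDr !(mulrCA (f _)).
by rewrite !big_split/= -!mulr_sumr shift.
Qed.

Lemma sum_by_parts2 (r s t u : F) g z M N :
  (forall l, g M l = 0) -> (forall k, g k N = 0) ->
  \sum_(0 <= k < M) \sum_(0 <= l < N)
     (r * (t * g k l + u * g k l.+1) + s * (t * g k.+1 l + u * g k.+1 l.+1))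
     * z k l =
  \sum_(0 <= k < M) \sum_(0 <= l < N)
     g k l * (r * (t * z k l + u * delay (z k) l)
              + s * delay (fun k' => t * z k' l + u * delay (z k') l) k).
Proof.
move=> gM gN; rewrite exchange_big_nat/=.
under eq_bigr => l _.
  rewrite (@sum_by_parts r s (fun k => t * g k l + u * g k l.+1)
    (z ^~ l)) ?gM ?mulr0 ?addr0//.
  over.
rewrite exchange_big_nat/=; apply: eq_bigr => k _.
rewrite (@sum_by_parts t u (g k) (fun l => r * z k l + s * delay (z^~ l) k))//.
apply: eq_bigr => l _; congr (_ * _).
by case: k l => [|k] [|l] /=; ring.
Qed.

(** The solution of the backward recurrence [h k = f k + q * h k.+1] below [N] with [h N = 0]. For
    [q = - s / r] and [f] divided by [r] it inverts the transposed operator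
    [r * h k + s * h k.+1]. *)
Definition tail_sum (q : F) N f k := \sum_(k <= j < N) q ^+ (j - k) * f j.

Lemma tail_sum_rec q N f k : (k < N)%N ->
  tail_sum q N f k = f k + q * tail_sum q N f k.+1.
Proof.
move=> kN; rewrite /tail_sum big_ltn// subnn mul1r mulr_sumr; congr (_ + _).
by apply: eq_big_nat => j /andP[kj _]; rewrite mulrA -exprS subnSK.
Qed.

Definition tail_sum2 (p q : F) M N g k l :=
  tail_sum p M (fun j => tail_sum q N (g j) l) k.

Lemma tail_sum2_geqr p q M N g k l : (N <= l)%N -> tail_sum2 p q M N g k l = 0.
Proof.
move=> Nl; rewrite /tail_sum2 {1}/tail_sum big1// => j _.
by rewrite /tail_sum big_geq// mulr0.
Qed.

Lemma tail_sum2_geql p q M N g k l : (M <= k)%N -> tail_sum2 p q M N g k l = 0.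
Proof. by move=> Mk; rewrite /tail_sum2 {1}/tail_sum big_geq. Qed.

(** The ratio [- s / r] makes [r * h k + s * h k.+1] collapse to a single term, and [- u / t] does
    the same in the other index. The bounds on [k] and [l] let a first term be split off each
    tail. *)
Lemma tail_sum2_rec (r s t u : F) M N g k l : r != 0 -> t != 0 ->
    (k < M)%N -> (l < N)%N ->
  let h := tail_sum2 (- s / r) (- u / t) M N (fun j i => g j i / (r * t)) in
  g k l = r * (t * h k l + u * h k l.+1) + s * (t * h k.+1 l + u * h k.+1 l.+1).
Proof.
move=> r0 t0 kM lN /=; rewrite /tail_sum2.
rewrite !(@tail_sum_rec _ M _ k)// (@tail_sum_rec _ N _ l)//.
by field; rewrite r0 t0.
Qed.

(** Forward substitution for [r * x k + s * delay x k = y k]. *)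
Fixpoint solve (r s : F) y k :=
  if k is k'.+1 then (y k - s * solve r s y k') / r else y 0%N / r.

Lemma solveK (r s : F) y k : r != 0 ->
  r * solve r s y k + s * delay (solve r s y) k = y k.
Proof. by move=> r0; case: k => [|k]/=; field. Qed.

End TwoTermOperator.

(** * The real-valued modulus on complex numbers *)

Section Modulus.
Variable R : realType.
Implicit Types z w : R[i].

Lemma modulus0 : modulus (0 : R[i]) = 0.
Proof. exact: ComplexField.Normc.normc0. Qed.

Lemma modulusM z w : modulus (z * w) = modulus z * modulus w.
Proof. exact: ComplexField.Normc.normcM. Qed.

Lemma modulusV z : modulus z^-1 = (modulus z)^-1.
Proof. exact: ComplexField.Normc.normcV. Qed.

Lemma modulusE z : `|z| = (modulus z)%:C%C.
Proof. by case: z. Qed.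

Lemma modulus_ge0 z : 0 <= modulus z.
Proof. by case: z => a b; exact: sqrtr_ge0. Qed.
#[local] Hint Extern 0 (is_true (0 <= modulus _)) => exact: modulus_ge0 : core.

Lemma modulus_real (x : R) : modulus x%:C%C = `|x|.
Proof. by rewrite /modulus/= expr0n addr0 sqrtr_sqr. Qed.

Lemma modulusN z : modulus (- z) = modulus z.
Proof. by case: z => a b; rewrite /modulus/= !sqrrN. Qed.

Lemma modulusD z w : modulus (z + w) <= modulus z + modulus w.
Proof. exact: le_normcD. Qed.

Lemma modulus_sum (I : Type) (r : seq I) (P : pred I) (f : I -> R[i]) :
  modulus (\sum_(i <- r | P i) f i) <= \sum_(i <- r | P i) modulus (f i).
Proof.
elim/big_ind2 : _ => //; first by rewrite modulus0.
by move=> x1 x2 y1 y2 h1 h2; apply: le_trans (modulusD _ _) (lerD h1 h2).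
Qed.

Lemma modulus_Re z : `|complex.Re z| <= modulus z.
Proof.
case: z => a b; rewrite /modulus/= -sqrtr_sqr ler_sqrt ?lerDl ?sqr_ge0//.
by rewrite addr_ge0// sqr_ge0.
Qed.

Lemma modulus_Im z : `|complex.Im z| <= modulus z.
Proof.
case: z => a b; rewrite /modulus/= -sqrtr_sqr ler_sqrt ?lerDr ?sqr_ge0//.
by rewrite addr_ge0// sqr_ge0.
Qed.

End Modulus.
#[local] Hint Extern 0 (is_true (0 <= modulus _)) => exact: modulus_ge0 : core.

(** * Finite sums over rectangles *)

Section RectangularSums.

Lemma big_nat_rect_widen (V : nmodType) (f : nat -> nat -> V) M M' N N' :
    (M <= M')%N -> (N <= N')%N ->
    (forall k l, (M <= k)%N || (N <= l)%N -> f k l = 0) ->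
  \sum_(0 <= k < M') \sum_(0 <= l < N') f k l =
  \sum_(0 <= k < M) \sum_(0 <= l < N) f k l.
Proof.
move=> MM' NN' f0; rewrite (big_cat_nat (leq0n M) MM')/=.
rewrite [X in _ + X]big_nat_cond [X in _ + X]big1 ?addr0; last first.
  by move=> k /andP[/andP[Mk _] _]; rewrite big1// => l _; rewrite f0// Mk.
apply: eq_bigr => k _; rewrite (big_cat_nat (leq0n N) NN')/=.
rewrite [X in _ + X]big_nat_cond [X in _ + X]big1 ?addr0//.
by move=> l /andP[/andP[Nl _] _]; rewrite f0// Nl orbT.
Qed.

(** Serves to test a kernel against a unit sequence, and to bound one entry by the sum over a
    square. *)
Lemma big_nat_rect_sum_delta (K : pzRingType) (f : nat -> nat -> K) M N k0 l0 :
  \sum_(0 <= k < M) \sum_(0 <= l < N) f k l * ((k == k0) && (l == l0))%:R =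
  if (k0 < M)%N && (l0 < N)%N then f k0 l0 else 0.
Proof.
have E k : \sum_(0 <= l < N) f k l * ((k == k0) && (l == l0))%:R =
    if k == k0 then (if (l0 < N)%N then f k l0 else 0) else 0.
  case: eqP => _ /=; last by rewrite big1// => l _; rewrite mulr0.
  rewrite -[RHS](big_nat1_eq +%R (f k) l0 0 N) [RHS]big_mkcond; apply: eq_bigr => l _.
  by case: eqP; rewrite ?mulr1 ?mulr0.
under eq_bigr do rewrite E.
rewrite -big_mkcond big_nat1_eq leq0n/=.
by case: (k0 < M)%N.
Qed.

Lemma ler_sum_rect (R : numDomainType) (f g : nat -> nat -> R) M N :
    (forall k l, (k < M)%N -> (l < N)%N -> f k l <= g k l) ->
  \sum_(0 <= k < M) \sum_(0 <= l < N) f k l <=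
  \sum_(0 <= k < M) \sum_(0 <= l < N) g k l.
Proof.
move=> fg; rewrite big_nat [leRHS]big_nat; apply: ler_sum => k /andP[_ kM].
rewrite big_nat [leRHS]big_nat; apply: ler_sum => l /andP[_ lN].
exact: fg.
Qed.

Lemma modulus_sum_rect (R : realType) (f : dseq R) M N :
  modulus (\sum_(0 <= k < M) \sum_(0 <= l < N) f k l) <=
  \sum_(0 <= k < M) \sum_(0 <= l < N) modulus (f k l).
Proof.
by apply: le_trans (modulus_sum _ _ _) _; apply: ler_sum => k _;
  exact: modulus_sum.
Qed.

End RectangularSums.

(** Smallness is required outside a finite square, so this is $c_0$ over the set of index pairs. It
    is stronger than a zero Pringsheim limit, which leaves any fixed row or column unconstrained. *)
Definition vanishing (R : realType) (y : dseq R) :=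
  forall e : R, 0 < e ->
    exists N, forall k l, (N <= maxn k l)%N -> modulus (y k l) <= e.

Lemma vanishing_delta (R : realType) k0 l0 :
  vanishing (fun k l => ((k == k0) && (l == l0))%:R : R[i]).
Proof.
move=> e e0; exists (maxn k0 l0).+1 => k l kl.
suff -> : (k == k0) && (l == l0) = false by rewrite modulus0 ltW.
by apply/negP => /andP[/eqP kk0 /eqP ll0]; rewrite kk0 ll0 ltnn in kl.
Qed.

(** * Gliding hump for families of finitely supported kernels *)

Section GlidingHump.
Context {R : realType} {J : Type}.
Variables (D : J -> dseq R) (supp : J -> nat).
Hypothesis D_supp : forall j k l, (supp j <= maxn k l)%N -> D j k l = 0.
Local Notation sq N f := (\sum_(0 <= k < N) \sum_(0 <= l < N) f k l).
Hypothesis D_bounded : forall y, vanishing y ->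
  exists M : R, forall j, modulus (sq (supp j) (fun k l => D j k l * y k l)) <= M.

Local Lemma widen_sq (V : nmodType) (f : nat -> nat -> V) N N' :
  (N <= N')%N -> (forall k l, (N <= maxn k l)%N -> f k l = 0) ->
  sq N' f = sq N f.
Proof.
by move=> NN' f0; apply: big_nat_rect_widen => // k l;
  rewrite -leq_max; exact: f0.
Qed.

(** Unit sequences vanish at infinity, so each entry of [D j] is bounded uniformly in [j], and a
    fixed square has finitely many entries. *)
Local Lemma square_bound N : exists C : R,
  0 <= C /\ forall j, sq N (fun k l => modulus (D j k l)) <= C.
Proof.
have /choice[M MP] : forall kl : nat * nat, exists M : R,
    forall j, modulus (D j kl.1 kl.2) <= M.
  move=> [k0 l0] /=; have [M MP] := D_bounded (@vanishing_delta R k0 l0).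
  exists M => j; have := MP j; rewrite big_nat_rect_sum_delta.
  case: ifPn => //; rewrite -gtn_max -leqNgt => /D_supp ->.
  by rewrite modulus0.
exists (sq N (fun k l => `|M (k, l)|)); split.
  by apply: sumr_ge0 => k _; apply: sumr_ge0.
move=> j; apply: ler_sum => k _; apply: ler_sum => l _.
exact: le_trans (MP (k, l) j) (ler_norm _).
Qed.

(* If the absolute sums were unbounded, one could pick indices [j_p] and
   squares [N_p] such that most of the mass of [D j_p] lies between the squares
   of sides [N_p] and [N_(p+1)]; a sequence aligned with [D j_p] and of modulus
   [1 / (p+1)] there (or [0 / 0 = 0] where [D j_p] vanishes) tends to zero but
   is unbounded against [D]. *)
Lemma gliding_hump : exists M : R, forall j,
  sq (supp j) (fun k l => modulus (D j k l)) <= M.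
Proof.
apply: contrapT => /forallNP unb.
have {}unb M : exists j, M < sq (supp j) (fun k l => modulus (D j k l)).
  by have /existsNP[j /negP] := unb M; rewrite -ltNge; exists j.
have /choice[C CP] := square_bound.
(* For [Np = (N, p)] the threshold is tuned to the weight [1 / (p+1)]: the weighted mass exceeds
   [2 * C N + p], which absorbs an error [2 * C N] from the inner square and still leaves more than
   [p]. *)
have /choice[J_ J_P] : forall Np : nat * nat, exists j,
   Np.2.+1%:R * (2 * C Np.1 + Np.2%:R) <
     sq (supp j) (fun k l => modulus (D j k l)) by [].
(* The next square covers the support of the kernel chosen at stage [p']. The successor makes [N_]
   strictly increasing, so the squares exhaust all indices. *)
pose fix N_ p := if p is p'.+1 then maxn (N_ p').+1 (supp (J_ (N_ p', p'))) else 0%N.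
have N_S p : (N_ p < N_ p.+1)%N by rewrite /= leq_maxl.
have N_mono : {homo N_ : p q / (p <= q)%N}.
  by apply: homo_leq => //; [exact: leq_trans | move=> p; exact: ltnW].
have N_ge p : (p <= N_ p)%N.
  by elim: p => // p ih; exact: leq_ltn_trans ih (N_S p).
have N_ex K : exists p, (K < N_ p.+1)%N by exists K; exact: N_ge.
pose level k l := ex_minn (N_ex (maxn k l)).
have level_ge p k l : (N_ p <= maxn k l)%N -> (p <= level k l)%N.
  rewrite /level; case: ex_minnP => q qP _ Nkl; rewrite leqNgt; apply/negP => qp.
  by have := leq_trans qP (leq_trans (N_mono _ _ qp) Nkl); rewrite ltnn.
have level_le p k l : (maxn k l < N_ p.+1)%N -> (level k l <= p)%N.
  by rewrite /level; case: ex_minnP => q _; apply.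
pose y : dseq R := fun k l => let d := D (J_ (N_ (level k l), level k l)) k l in
  (((level k l).+1%:R)^-1)%:C%C * ((modulus d)%:C%C / d).
have y_le : forall k l, modulus (y k l) <= (level k l).+1%:R^-1.
  move=> k l.
  rewrite /y; set d := D _ _ _.
  rewrite !modulusM modulusV !modulus_real !ger0_norm ?invr_ge0 ?modulus_ge0//.
  have [->|d0] := eqVneq (modulus d) 0; first by rewrite mul0r mulr0.
  by rewrite divff// mulr1.
have y_van : vanishing y.
  (* Outside this square the level is at least [truncn (1 / e)], whence [1 / (level + 1) <= e]. *)
  move=> e e0; exists (N_ (Num.truncn e^-1)) => k l kl; have {}kl := level_ge _ _ _ kl.
  apply: (le_trans (y_le k l)); rewrite -[leRHS]invrK lef_pV2 ?posrE ?invr_gt0//.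
  apply/ltW/(lt_le_trans (truncnS_gt _)).
  by rewrite ler_nat ltnS.
have [M MP] := D_bounded y_van.
(* This stage satisfies [M < p], so its hump exceeds the supposed bound [M]. *)
pose p := (Num.truncn M).+1; pose j := J_ (N_ p, p); pose C0 := C (N_ p).
have [C0_ge C0P] := CP (N_ p).
have sjN : (supp j <= N_ p.+1)%N by rewrite /= leq_maxr.
have Dj0 k l : (supp j <= maxn k l)%N -> modulus (D j k l) = 0.
  by move=> /D_supp ->; rewrite modulus0.
have Dyj0 k l : (supp j <= maxn k l)%N -> D j k l * y k l = 0.
  by move=> /D_supp ->; rewrite mul0r.
pose eps : R := p.+1%:R^-1.
have eps_gt0 : 0 < eps by rewrite invr_gt0.
have eps_le1 : eps <= 1 by rewrite invf_le1// ler1n.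
(* The deviation from perfect alignment at weight [eps]. It vanishes on the annulus of stage [p] and
   is at most twice the modulus of [D j] on the inner square, so its total there is at most
   [2 * C0]. *)
pose err k l : R[i] := D j k l * y k l - (eps * modulus (D j k l))%:C%C.
have err0 k l : (maxn k l < N_ p.+1)%N -> (N_ p <= maxn k l)%N -> err k l = 0.
  move=> /level_le lep /level_ge gep.
  have lp : level k l = p by apply/eqP; rewrite eqn_leq lep.
  rewrite /err /y lp -/j -/eps rmorphM/=.
  have [->|d0] := eqVneq (D j k l) 0; first by rewrite modulus0 !mul0r mulr0 subrr.
  by apply/eqP; rewrite subr_eq0; apply/eqP; field.
have err_le k l : modulus (err k l) <= 2 * modulus (D j k l).
  apply: le_trans (modulusD _ _) _; rewrite modulusN modulusM modulus_real.
  rewrite ger0_norm ?mulr_ge0 ?modulus_ge0 ?(ltW eps_gt0)//.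
  have : modulus (y k l) <= 1.
    by apply: (le_trans (y_le k l)); rewrite invf_le1// ler1n.
  move=> y_le1; rewrite [leRHS](mulr_natl _ 2%N) mulr2n; apply: lerD.
    by rewrite ler_piMr.
  by rewrite ler_piMl.
have : eps * sq (N_ p.+1) (fun k l => modulus (D j k l)) <= M + 2 * C0.
  apply: (@le_trans _ _ (modulus (sq (N_ p.+1) (fun k l => D j k l * y k l)) +
     sq (N_ p.+1) (fun k l => modulus (err k l)))).
    apply: (@le_trans _ _ (modulus (sq (N_ p.+1) (fun k l => D j k l * y k l)) +
       modulus (- sq (N_ p.+1) err))); last first.
      by rewrite lerD2l modulusN; exact: modulus_sum_rect.
    apply: le_trans (modulusD _ _).
    (* The weighted mass is real, hence equals the real part of the difference of the two complex
       sums. *)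
    apply: le_trans (modulus_Re _); apply: le_trans (ler_norm _).
    rewrite le_eqVlt; apply/orP; left; apply/eqP.
    rewrite -[LHS]/(complex.Re (_%:C)%C); congr complex.Re.
    rewrite rmorphM/= rmorph_sum/= mulr_sumr -sumrB; apply: eq_bigr => k _.
    rewrite rmorph_sum/= mulr_sumr -sumrB; apply: eq_bigr => l _.
    by rewrite /err rmorphM/= opprB addrC subrK.
  apply: lerD; first by rewrite (widen_sq sjN Dyj0).
  have -> : sq (N_ p.+1) (fun k l => modulus (err k l)) = sq (N_ p.+1)
      (fun k l => if (maxn k l < N_ p)%N then modulus (err k l) else 0).
    apply: eq_big_nat => k /andP[_ kN]; apply: eq_big_nat => l /andP[_ lN].
    by case: ltnP => // /err0 ->; rewrite ?modulus0// gtn_max kN.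
  rewrite (@widen_sq _ _ (N_ p)) ?(ltnW (N_S p))//; last first.
    by move=> k l; rewrite leqNgt => /negbTE ->.
  apply: le_trans (_ : 2 * sq (N_ p) (fun k l => modulus (D j k l)) <= _).
    rewrite mulr_sumr; apply: ler_sum => k _.
    rewrite mulr_sumr; apply: ler_sum => l _.
    by case: ifP => // _; rewrite mulr_ge0.
  by rewrite ler_pM2l.
rewrite (widen_sq sjN Dj0) mulrC ler_pdivrMr//.
apply/negP; rewrite -ltNge; apply: le_lt_trans (J_P (N_ p, p)) => /=.
rewrite mulrC ler_pM2l// addrC lerD2l.
exact/ltW/truncnS_gt.
Qed.

End GlidingHump.

(** * Strong almost convergence, between vanishing at infinity and boundedness *)

Lemma near_prod_ge m0 n0 :
  \forall mn \near filter_prod \oo \oo, (m0 <= mn.1)%N /\ (n0 <= mn.2)%N.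
Proof.
exists ([set m | (m0 <= m)%N], [set n | (n0 <= n)%N]) => /=.
  by split; exact: nbhs_infty_ge.
by move=> [m n].
Qed.

Section StronglyAlmostConvergent.
Variable R : realType.
Implicit Types x y : dseq R.

Lemma cvge_ge0_le (T : Type) (F : set_system T) (FF : Filter F)
    (f : T -> \bar R) :
    (forall i, (0 <= f i)%E) ->
    (forall e : R, 0 < e -> \forall i \near F, (f i <= e%:E)%E) ->
  f @ F --> (0 : \bar R)%E.
Proof.
move=> f0 fe; apply/fine_cvgP; split.
  apply: filterS (fe 1 ltr01) => i fi; rewrite ge0_fin_numE ?f0//.
  exact: le_lt_trans fi (ltry _).
apply/cvgrPdist_le => e e0; apply: filterS (fe e e0) => i fi /=.
have fin_fi : f i \is a fin_num.
  by rewrite ge0_fin_numE ?f0//; exact: le_lt_trans fi (ltry _).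
rewrite sub0r normrN ger0_norm ?fine_ge0 ?f0//.
by rewrite -lee_fin fineK.
Qed.

Lemma vanishing_bounded y : vanishing y -> dseq_bounded y.
Proof.
move=> /(_ 1 ltr01)[N yN].
exists (1 + \sum_(0 <= k < N) \sum_(0 <= l < N) modulus (y k l)) => k l.
have [/yN kl|] := leqP N (maxn k l).
  apply: le_trans kl _; rewrite lerDl.
  by apply: sumr_ge0 => i _; apply: sumr_ge0.
rewrite gtn_max => /andP[kN lN]; apply: ler_wpDl => //.
have E := big_nat_rect_sum_delta (fun k l => modulus (y k l)) N N k l.
rewrite kN lN/= in E; rewrite -E; apply: ler_sum => i _; apply: ler_sum => j _.
by case: (_ && _); rewrite ?mulr1 ?mulr0.
Qed.

(** At most [N] rows of a window lie below [N], wherever the window starts; this gives uniformity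
    over all windows. *)
Lemma sum_nat_ltn_le m q N : (\sum_(m <= k < m + q) (k < N) <= N - m)%N.
Proof.
elim: q m => [|q IH] m; first by rewrite addn0 big_geq.
rewrite big_ltn ?addnS ?ltnS ?leq_addr//.
by have := IH m.+1; rewrite addSn; case: ltnP; lia.
Qed.

(** With limit 0, split a window by rows. Rows below [N] have entries at most [M], the others at
    most [e / 2], so the mean is at most [M * N / (q+1) + e / 2]. *)
Lemma vanishing_strongly_almost_cvg y : vanishing y -> strongly_almost_cvg y.
Proof.
move=> y_van; exists 0; apply: cvge_ge0_le => [qq|e e0].
  apply: le_trans (ereal_sup_ubound (ex_intro2 _ _ (0%N, 0%N) I erefl)).
  rewrite lee_fin /window_mean mulr_ge0 ?invr_ge0 ?mulr_ge0//.
  by apply: sumr_ge0 => k _; apply: sumr_ge0.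
have [M yM] := vanishing_bounded y_van.
have M0 : 0 <= M by exact: le_trans (modulus_ge0 _) (yM 0%N 0%N).
have e20 : 0 < e / 2 by rewrite divr_gt0.
have [N yN] := y_van _ e20.
(* Chosen so that [M * N / (q+1) <= e / 2] whenever [K <= q]. *)
pose K := Num.truncn (M * N%:R / (e / 2)).
apply: filterS (near_prod_ge K K) => -[q q'] /= [qK _].
have Kq : M * N%:R / (e / 2) <= q.+1%:R.
  by apply/ltW/(lt_le_trans (truncnS_gt _)); rewrite ler_nat ltnS.
apply: ge_ereal_sup => _ [[m n] _ <-] /=; rewrite lee_fin /window_mean.
rewrite mulrC ler_pdivrMr ?mulr_gt0//.
apply: (@le_trans _ _ (\sum_(m <= k < (m + q).+1) \sum_(n <= l < (n + q').+1)
   (M * (k < N)%N%:R + e / 2))).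
  apply: ler_sum => k _; apply: ler_sum => l _; rewrite subr0.
  case: ltnP => kN; first by rewrite mulr1 ler_wpDr// ltW.
  by rewrite mulr0 add0r yN// leq_max kN.
under eq_bigr do rewrite sumr_const_nat -addnS addKn.
rewrite sumrMnl -addnS big_split/= sumr_const_nat addKn -mulr_sumr -natr_sum.
have /(ler_wpM2l M0) : (\sum_(m <= k < m + q.+1) (k < N)%N)%:R <= N%:R :> R.
  by rewrite ler_nat (leq_trans (sum_nat_ltn_le _ _ _))// leq_subr.
rewrite ler_pdivrMr// in Kq.
move=> MN; rewrite -[leLHS]mulr_natr mulrA ler_pM2r// -(mulr_natr (e / 2)).
lra.
Qed.

(** One window size with all means below 1 suffices: the modulus of [y m n - L] is the corner term
    of the window at [(m, n)], hence at most [(q+1) * (q'+1)]. *)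
Lemma strongly_almost_cvg_bounded y : strongly_almost_cvg y -> dseq_bounded y.
Proof.
move=> [L yL].
have lt1 : nbhs (0 : \bar R)%E [set z | (z < 1%:E)%E].
  by apply: open_ereal_lt'; rewrite lte_fin.
have [[q q'] /= sup1] := @filter_ex _ (filter_prod \oo \oo) _ _ (yL _ lt1).
exists (q.+1%:R * q'.+1%:R + modulus L) => m n.
rewrite -[y m n](subrK L); apply: le_trans (modulusD _ _) _.
rewrite lerD2r.
have : window_mean y L q q' m n <= 1.
  rewrite -lee_fin; apply: le_trans (ltW sup1).
  by apply: ereal_sup_ubound; exists (m, n).
rewrite /window_mean mulrC ler_pdivrMr ?mulr_gt0// mul1r; apply: le_trans.
have mq : (m < (m + q).+1)%N by rewrite ltnS leq_addr.
have nq : (n < (n + q').+1)%N by rewrite ltnS leq_addr.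
rewrite (big_ltn mq) (big_ltn nq).
rewrite -addrA lerDl addr_ge0//; first exact: sumr_ge0.
by apply: sumr_ge0 => k _; apply: sumr_ge0.
Qed.

End StronglyAlmostConvergent.

(** * Convergence of absolutely summable double series in all three modes *)

Section AbsoluteConvergence.
Variable R : realType.

Lemma cvg_complex (T : Type) (F : set_system T) (FF : Filter F)
    (z : T -> R[i]) (a b : R) :
    (fun i => complex.Re (z i)) @ F --> a ->
    (fun i => complex.Im (z i)) @ F --> b ->
  (fun i => z i : R[i]^o) @ F --> (Complex a b : R[i]^o).
Proof.
move=> /cvgrPdist_le za /cvgrPdist_le zb; apply/cvgrPdist_le => -[e ei].
(* In the order of [R[i]] a positive tolerance has zero imaginary part. *)
rewrite ltcE/= => /andP[/eqP ei0 e0]; rewrite {ei}ei0.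
have e20 : 0 < e / 2 by rewrite divr_gt0.
near=> i.
have -> : `|(Complex a b : R[i]^o) - z i| = (modulus (Complex a b - z i))%:C%C.
  by rewrite -modulusE.
rewrite lecE/= eqxx/=.
rewrite [X in modulus X]complexE; apply: le_trans (modulusD _ _) _.
rewrite modulusM !modulus_real [modulus 'i%C](_ : _ = 1); last first.
  by rewrite /modulus/= expr0n expr1n add0r sqrtr1.
rewrite mul1r [leRHS]splitr lerD//.
  by rewrite raddfB/=; near: i; exact: za.
by rewrite raddfB/=; near: i; exact: zb.
Unshelve. all: by end_near. Qed.

(** Abstracting the filter lets one argument yield Pringsheim limits as well as limits along each
    row and column. *)
Definition monotone_cvg (F : set_system (nat * nat)) :=
  forall g : nat -> nat -> R,
    (forall m m' n n', (m <= m')%N -> (n <= n')%N -> g m n <= g m' n') ->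
    (exists M, forall m n, g m n <= M) ->
  exists L : R, (fun mn => g mn.1 mn.2) @ F --> L.

Lemma monotone_cvg_prod : monotone_cvg (filter_prod \oo \oo).
Proof.
move=> g g_mono [M gM].
pose A := [set g mn.1 mn.2 | mn in [set: nat * nat]].
have A_sup : has_sup A.
  by split; [exists (g 0%N 0%N), (0%N, 0%N) | exists M => _ [mn _ <-]].
exists (sup A); apply/cvgrPdist_le => e e0.
have [_ [[m0 n0] _ <-] /= g0] := sup_adherent e0 A_sup.
apply: filterS (near_prod_ge m0 n0) => -[m n] /= [m0m n0n].
have gA : g m n <= sup A by apply: sup_upper_bound => //; exists (m, n).
rewrite ger0_norm ?subr_ge0// lerBlDr -lerBlDl.
exact: le_trans (ltW g0) (g_mono _ _ _ _ m0m n0n).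
Qed.

Lemma monotone_cvg_row m : monotone_cvg ((fun n => (m, n)) @ \oo).
Proof.
move=> g g_mono [M gM].
have /cvg_ex[L gL] : cvgn (g m).
  apply: nondecreasing_is_cvgn => [n n' nn'|]; first exact: g_mono.
  by exists M => _ [n _ <-].
by exists L.
Qed.

Lemma monotone_cvg_col n : monotone_cvg ((fun m => (m, n)) @ \oo).
Proof.
move=> g g_mono [M gM].
have /cvg_ex[L gL] : cvgn (g ^~ n).
  apply: nondecreasing_is_cvgn => [m m' mm'|]; first exact: g_mono.
  by exists M => _ [m _ <-].
by exists L.
Qed.

(** Write [f] as [(f + |f|) - |f|]: both parts are nonnegative, so their partial sums are monotone,
    with bounds [2 * C] and [C]. *)
Lemma abs_summable_cvg_real (F : set_system (nat * nat)) (FF : Filter F)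
    (f : nat -> nat -> R) (C : R) : monotone_cvg F ->
    (forall m n, \sum_(0 <= k < m) \sum_(0 <= l < n) `|f k l| <= C) ->
  exists L : R,
    (fun mn => \sum_(0 <= k < mn.1.+1) \sum_(0 <= l < mn.2.+1) f k l) @ F --> L.
Proof.
move=> F_cvg fC.
pose P (h : nat -> nat -> R) m n := \sum_(0 <= k < m.+1) \sum_(0 <= l < n.+1) h k l.
have P_mono h : (forall k l, 0 <= h k l) -> forall m m' n n',
    (m <= m')%N -> (n <= n')%N -> P h m n <= P h m' n'.
  move=> h0 m m' n n' mm' nn'; rewrite /P [leRHS](big_cat_nat (leq0n m.+1))//=.
  apply: ler_wpDr; first by apply: sumr_ge0 => k _; apply: sumr_ge0.
  apply: ler_sum => k _; rewrite [leRHS](big_cat_nat (leq0n n.+1))//=.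
  by apply: ler_wpDr; first by apply: sumr_ge0.
have abs_le (x : R) : 0 <= x + `|x| <= `|x| + `|x|.
  by rewrite lerD2r ler_norm -lerBlDr sub0r lerNnormlW.
have [L1 PL1] := F_cvg (P (fun k l => `|f k l|)) (P_mono _ (fun k l => normr_ge0 _))
  (ex_intro _ C (fun m n => fC m.+1 n.+1)).
have [L2 PL2] : exists L : R, (fun mn => P (fun k l => f k l + `|f k l|) mn.1 mn.2) @ F --> L.
  apply: (F_cvg (P (fun k l => f k l + `|f k l|))).
    by apply: P_mono => k l; case/andP: (abs_le (f k l)).
  exists (C + C) => m n; apply: (@le_trans _ _
    (P (fun k l => `|f k l| + `|f k l|) m n)).
    by apply: ler_sum => k _; apply: ler_sum => l _; case/andP: (abs_le (f k l)).
  rewrite /P; under eq_bigr do rewrite big_split/=.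
  by rewrite big_split/= lerD.
exists (L2 - L1); rewrite (_ : (fun mn => _) = (fun mn : nat * nat =>
  P (fun k l => f k l + `|f k l|) mn.1 mn.2 -
  P (fun k l => `|f k l|) mn.1 mn.2)); first exact: cvgB PL2 PL1.
apply/funext => -[m n] /=; rewrite /P -sumrB; apply: eq_bigr => k _.
by rewrite -sumrB; apply: eq_bigr => l _; rewrite addrK.
Qed.

Lemma abs_summable_cvg (F : set_system (nat * nat)) (FF : Filter F)
    (a : dseq R) (C : R) : monotone_cvg F ->
    (forall m n, \sum_(0 <= k < m) \sum_(0 <= l < n) modulus (a k l) <= C) ->
  exists L : R[i],
    (fun mn => partial_sum a mn.1 mn.2 : R[i]^o) @ F --> (L : R[i]^o).
Proof.
move=> F_cvg aC.
have [|x ax] := abs_summable_cvg_real (f := fun k l => complex.Re (a k l)) (C := C) FF F_cvg.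
  move=> m n; apply: le_trans (aC m n); apply: ler_sum => k _; apply: ler_sum => l _.
  exact: modulus_Re.
have [|y ay] := abs_summable_cvg_real (f := fun k l => complex.Im (a k l)) (C := C) FF F_cvg.
  move=> m n; apply: le_trans (aC m n); apply: ler_sum => k _; apply: ler_sum => l _.
  exact: modulus_Im.
exists (Complex x y); apply: cvg_complex.
  rewrite (_ : (fun i => complex.Re _) = (fun mn : nat * nat =>
    \sum_(0 <= k < mn.1.+1) \sum_(0 <= l < mn.2.+1) complex.Re (a k l)))//.
  apply/funext => mn; rewrite raddf_sum; apply: eq_bigr => k _.
  by rewrite raddf_sum.
rewrite (_ : (fun i => complex.Im _) = (fun mn : nat * nat =>
  \sum_(0 <= k < mn.1.+1) \sum_(0 <= l < mn.2.+1) complex.Im (a k l)))//.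
apply/funext => mn; rewrite raddf_sum; apply: eq_bigr => k _.
by rewrite raddf_sum.
Qed.

Lemma abs_summable_CS (a : dseq R) (C : R) theta :
    (forall m n, \sum_(0 <= k < m) \sum_(0 <= l < n) modulus (a k l) <= C) ->
  CS theta a.
Proof.
move=> aC.
have a_p : C_p (partial_sum a).
  exact: (abs_summable_cvg _ monotone_cvg_prod aC).
case: theta; first exact: a_p.
  by split=> //; exists C => m n; exact: le_trans (modulus_sum_rect _ _ _) (aC _ _).
split=> // [m|n].
  exact: (abs_summable_cvg _ (@monotone_cvg_row m) aC).
exact: (abs_summable_cvg _ (@monotone_cvg_col n) aC).
Qed.

End AbsoluteConvergence.

(** * The dual kernels and the two inclusions *)

Section GammaDual.
Variable R : realType.
Variables (r s t u : R).
Hypotheses (r0 : r != 0) (t0 : t != 0).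
Implicit Types (a x y : dseq R).

(** The inverse transpose of B applied to [a] cut off outside the rectangle with far corner
    [(m, n)]; [d1] bounds its absolute sums. *)
Definition dual_kernel a m n : dseq R := fun k l =>
  \sum_(k <= j < m.+1) \sum_(l <= i < n.+1)
    ((- s / r) ^+ (j - k) * (- u / t) ^+ (i - l))%:C%C * (a j i / (r * t)%:C%C).

Lemma dual_kernelE a m n k l : dual_kernel a m n k l =
  tail_sum2 (- s%:C%C / r%:C%C) (- u%:C%C / t%:C%C) m.+1 n.+1
    (fun j i => a j i / (r%:C%C * t%:C%C)) k l.
Proof.
rewrite /tail_sum2 /tail_sum; apply: eq_bigr => j _; rewrite mulr_sumr.
apply: eq_bigr => i _.
by rewrite !rmorphM/= !rmorphXn/= !rmorphM/= !rmorphN/= !fmorphV /= -!mulrA.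
Qed.

Lemma real_complex_neq0 (x : R) : x != 0 -> x%:C%C != 0 :> R[i].
Proof. by rewrite fmorph_eq0. Qed.

Lemma dual_kernel_rec a m n k l : (k <= m)%N -> (l <= n)%N ->
  let d := dual_kernel a m n in
  a k l = r%:C%C * (t%:C%C * d k l + u%:C%C * d k l.+1)
        + s%:C%C * (t%:C%C * d k.+1 l + u%:C%C * d k.+1 l.+1).
Proof.
move=> km ln /=; rewrite !dual_kernelE.
by apply: tail_sum2_rec; rewrite ?real_complex_neq0.
Qed.

Lemma dual_kernel_eq0 a m n k l :
  (m.+1 <= k)%N || (n.+1 <= l)%N -> dual_kernel a m n k l = 0.
Proof.
rewrite dual_kernelE => /orP[mk|nl]; first exact: tail_sum2_geql.
exact: tail_sum2_geqr.
Qed.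

Lemma B_transformE x k l : B_transform r s t u x k l =
  r%:C%C * (t%:C%C * x k l + u%:C%C * delay (x k) l)
  + s%:C%C * delay (fun k' => t%:C%C * x k' l + u%:C%C * delay (x k') l) k.
Proof.
by rewrite /B_transform; case: k l => [|k] [|l] /=; rewrite !rmorphM/=; ring.
Qed.

Lemma partial_sum_dual_kernel a x m n :
  partial_sum (fun k l => a k l * x k l) m n =
  \sum_(0 <= k < m.+1) \sum_(0 <= l < n.+1)
    dual_kernel a m n k l * B_transform r s t u x k l.
Proof.
transitivity (\sum_(0 <= k < m.+1) \sum_(0 <= l < n.+1)
    (r%:C%C * (t%:C%C * dual_kernel a m n k l + u%:C%C * dual_kernel a m n k l.+1)
    + s%:C%C * (t%:C%C * dual_kernel a m n k.+1 l
                + u%:C%C * dual_kernel a m n k.+1 l.+1)) * x k l).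
  apply: eq_big_nat => k /andP[_ km]; apply: eq_big_nat => l /andP[_ ln].
  by rewrite [X in X * _](@dual_kernel_rec a m n k l).
rewrite sum_by_parts2 => [|l|k]; last 2 first.
- by rewrite dual_kernel_eq0 ?leqnn.
- by rewrite dual_kernel_eq0 ?leqnn ?orbT.
apply: eq_bigr => k _; apply: eq_bigr => l _.
by rewrite B_transformE.
Qed.

(** B is a product of two triangular operators with diagonals [r] and [t], inverted one index at a
    time. *)
Lemma B_transform_surj y : exists x, B_transform r s t u x = y.
Proof.
pose z k l := solve r%:C%C s%:C%C (y ^~ l) k.
exists (fun k => solve t%:C%C u%:C%C (z k)).
apply/funext => k; apply/funext => l; rewrite B_transformE.
rewrite solveK ?real_complex_neq0//.
rewrite -[RHS](@solveK _ r%:C%C s%:C%C (y ^~ l)) ?real_complex_neq0//.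
congr (_ + _ * _); case: k => [|k] //=.
by rewrite solveK ?real_complex_neq0.
Qed.

Lemma d1P a : d1 r s t u a <-> exists M : R, forall m n,
  \sum_(0 <= k < m.+1) \sum_(0 <= l < n.+1) modulus (dual_kernel a m n k l) <= M.
Proof.
split=> [|[M aM]].
  rewrite /d1/=; set S := ereal_sup _ => S_lt.
  have S_ge m n : ((\sum_(0 <= k < m.+1) \sum_(0 <= l < n.+1)
      modulus (dual_kernel a m n k l))%:E <= S)%E.
    by apply: ereal_sup_ubound; exists (m, n).
  have S_ge0 : (0 <= S)%E.
    apply: le_trans (S_ge 0%N 0%N); rewrite lee_fin.
    by apply: sumr_ge0 => k _; apply: sumr_ge0.
  exists (fine S) => m n; rewrite -lee_fin fineK ?ge0_fin_numE//.
rewrite /d1/=; apply: (@le_lt_trans _ _ M%:E); last exact: ltry.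
by apply: ge_ereal_sup => _ [[m n] _ <-] /=; rewrite lee_fin; exact: aM.
Qed.

Lemma d1_abs_summable a : d1 r s t u a -> exists C : R, forall m n,
  \sum_(0 <= k < m) \sum_(0 <= l < n) modulus (a k l) <= C.
Proof.
move=> /d1P[M aM].
(* The transpose of B writes [a] as a combination of four shifts of the kernel; the factor before
   [M] is the sum of the moduli of its coefficients. *)
exists ((`|r| + `|s|) * (`|t| + `|u|) * M) => m n.
pose d := dual_kernel a m n; pose e k l := modulus (d k l).
pose P (h : nat -> nat -> R) := \sum_(0 <= k < m.+1) \sum_(0 <= l < n.+1) h k l.
have sum_shift (V : nmodType) (h : nat -> V) N : h N = 0 ->
    \sum_(0 <= k < N) h k.+1 + h 0%N = \sum_(0 <= k < N) h k.
  by move=> hN; rewrite addrC -big_nat_recl// big_nat_recr//= hN addr0.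
(* Shifting a nonnegative array that is zero just past the rectangle only discards its first row. *)
have shift1_le h : (forall k l, 0 <= h k l) -> (forall l, h m.+1 l = 0) ->
    P (fun k l => h k.+1 l) <= P h.
  move=> h0 hm; rewrite /P -[leRHS]sum_shift ?lerDl; last first.
    by rewrite big1.
  exact: sumr_ge0.
have shift2_le h : (forall k l, 0 <= h k l) -> (forall k, h k n.+1 = 0) ->
    P (fun k l => h k l.+1) <= P h.
  move=> h0 hn; rewrite /P; apply: ler_sum => k _.
  by rewrite -[leRHS]sum_shift ?lerDl.
have e0 k l : 0 <= e k l by exact: modulus_ge0.
have em l : e m.+1 l = 0 by rewrite /e /d dual_kernel_eq0 ?leqnn ?modulus0.
have en k : e k n.+1 = 0 by rewrite /e /d dual_kernel_eq0 ?leqnn ?orbT ?modulus0.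
have Pe : P e <= M := aM m n.
have Pe1 : P (fun k l => e k.+1 l) <= M by exact: le_trans (shift1_le _ e0 em) Pe.
have Pe2 : P (fun k l => e k l.+1) <= M by exact: le_trans (shift2_le _ e0 en) Pe.
have Pe12 : P (fun k l => e k.+1 l.+1) <= M.
  by apply: le_trans (shift1_le (fun k l => e k l.+1) _ _) Pe2.
have mn_le : \sum_(0 <= k < m) \sum_(0 <= l < n) modulus (a k l) <=
    P (fun k l => modulus (a k l)).
  rewrite /P big_nat_recr//=; apply: ler_wpDr; first exact: sumr_ge0.
  by apply: ler_sum => k _; rewrite big_nat_recr//= lerDl.
apply: le_trans mn_le _.
apply: (@le_trans _ _ (P (fun k l => `|r| * (`|t| * e k l + `|u| * e k l.+1)
    + `|s| * (`|t| * e k.+1 l + `|u| * e k.+1 l.+1)))).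
  apply: ler_sum_rect => k l km ln.
  rewrite [X in modulus X](@dual_kernel_rec a m n k l)//.
  have step (x y : R) z w : modulus (x%:C%C * z + y%:C%C * w) <=
      `|x| * modulus z + `|y| * modulus w.
    by apply: le_trans (modulusD _ _) _; rewrite !modulusM !modulus_real.
  apply: le_trans (step _ _ _ _) _.
  by apply: lerD; apply: ler_wpM2l => //; exact: step.
have PD (x y : R) f g :
    P (fun k l => x * f k l + y * g k l) = x * P f + y * P g.
  rewrite /P !mulr_sumr -big_split; apply: eq_bigr => k _ /=.
  by rewrite !mulr_sumr -big_split.
rewrite (PD `|r| `|s| (fun k l => `|t| * e k l + `|u| * e k l.+1)
  (fun k l => `|t| * e k.+1 l + `|u| * e k.+1 l.+1)).
rewrite (PD `|t| `|u| e (fun k l => e k l.+1)).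
rewrite (PD `|t| `|u| (fun k l => e k.+1 l) (fun k l => e k.+1 l.+1)).
by rewrite -mulrA !mulrDl; apply: lerD; apply: ler_wpM2l => //; apply: lerD;
  exact: ler_wpM2l.
Qed.

(** An $\ell_1$-$\ell_\infty$ estimate: kernels of absolute sum at most [M] are paired with [B x],
    bounded by [K]. *)
Lemma d1_gamma_dual a :
  d1 r s t u a -> gamma_dual (B_domain r s t u (@strongly_almost_cvg R)) a.
Proof.
move=> /d1P[M aM] x /strongly_almost_cvg_bounded[K xK].
exists (M * K) => m n; rewrite partial_sum_dual_kernel.
apply: le_trans (modulus_sum_rect _ _ _) _.
have K0 : 0 <= K := le_trans (modulus_ge0 _) (xK 0%N 0%N).
apply: le_trans (ler_wpM2r K0 (aM m n)).
rewrite mulr_suml; apply: ler_sum => k _; rewrite mulr_suml; apply: ler_sum => l _.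
by rewrite modulusM ler_wpM2l.
Qed.

Lemma gamma_dual_d1 a :
  gamma_dual (B_domain r s t u (@strongly_almost_cvg R)) a -> d1 r s t u a.
Proof.
move=> a_dual; apply/d1P.
pose D (mn : nat * nat) := dual_kernel a mn.1 mn.2.
(* The gliding hump works on squares, so each rectangle is enclosed in one; the kernel is zero on
   the excess. *)
pose supp (mn : nat * nat) := (maxn mn.1 mn.2).+1.
have sq_rect (V : nmodType) (h : nat -> nat -> V) m n :
    (forall k l, (m.+1 <= k)%N || (n.+1 <= l)%N -> h k l = 0) ->
    \sum_(0 <= k < supp (m, n)) \sum_(0 <= l < supp (m, n)) h k l =
    \sum_(0 <= k < m.+1) \sum_(0 <= l < n.+1) h k l.
  by move=> h0; rewrite (big_nat_rect_widen _ _ h0)// ltnS ?leq_maxl ?leq_maxr.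
have [||M DM] := @gliding_hump R _ D supp.
- move=> [m n] k l; rewrite /supp /D/= => mnkl; apply: dual_kernel_eq0.
  by lia.
- move=> y /vanishing_strongly_almost_cvg y_sac.
  (* Surjectivity turns the hypothesis on [a] into bounded pairings of the kernels with every
     vanishing [y]. *)
  have [x xy] := B_transform_surj y.
  have [|M axM] := a_dual x; first by rewrite /B_domain/= xy.
  exists M => -[m n]; rewrite sq_rect => [|k l kl]; last first.
    by rewrite /D dual_kernel_eq0 ?mul0r.
  by have := axM m n; rewrite partial_sum_dual_kernel xy.
exists M => m n; have := DM (m, n); rewrite sq_rect// => k l kl.
by rewrite /D dual_kernel_eq0 ?modulus0.
Qed.

End GammaDual.

Theorem theorem4p9 (R : realType) (r s t u : R)
    (hr : r != 0) (hs : s != 0) (ht : t != 0) (hu : u != 0)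
    (theta : cvg_mode) :
  gamma_dual (B_domain r s t u (@strongly_almost_cvg R)) =
  d1 r s t u `&` @CS R theta.
Proof.
apply/seteqP; split=> [a /(gamma_dual_d1 hr ht) a_d1|a [a_d1 _]].
  by split=> //; have [C /abs_summable_CS] := d1_abs_summable hr ht a_d1; apply.
exact: d1_gamma_dual.
Qed.
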